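(* Let $m,n\in\mathbb N$, let $D=\mathrm{diag}\{d_1,\dots,d_m\}$ and $\widehat D=\mathrm{diag}\{\widehat d_1,\dots,\widehat d_m\}$ be real diagonal matrices, let $B=\mathrm{diag}\{b_1,\dots,b_m\}$ with $b_k=\pm1$, and let $A\in\mathbb C^{n\times n}$. Let $\varrho(x,t)$ ($x\ge 0$, $t\ge 0$) be a differentiable $m\times m$ matrix function with $\varrho^*=B\varrho B$ satisfying the $N$-wave equation $$[D,\varrho_t]-[\widehat D,\varrho_x]=\big[[D,\varrho],[\widehat D,\varrho]\big].$$ Then, for $n\times m$ matrices $\Pi$, the equalities $$\big(-\mathrm i A\Pi D+\Pi[D,\varrho]\big)_t=\big(-\mathrm i A\Pi\widehat D+\Pi[\widehat D,\varrho]\big)_x,\qquad \big(\Pi DB\Pi^*\big)_t=\big(\Pi\widehat D B\Pi^*\big)_x$$ hold, where the derivatives are expanded by the product rule and $\Pi_x$ is substituted by $-\mathrm i A\Pi D+\Pi[D,\varrho]$ and $\Pi_t$ is substituted by $-\mathrm i A\Pi\widehat D+\Pi[\widehat D,\varrho]$. That is, writing $X:=-\mathrm i A\Pi D+\Pi[D,\varrho]$ and $T:=-\mathrm i A\Pi\widehat D+\Pi[\widehat D,\varrho]$, one has at every point $(x,t)$ and for every $\Pi\in\mathbb C^{n\times m}$ $$-\mathrm i A T D+T[D,\varrho]+\Pi[D,\varrho_t]=-\mathrm i A X\widehat D+X[\widehat D,\varrho]+\Pi[\widehat D,\varrho_x],$$ $$T DB\Pi^*+\Pi DB T^*=X\widehat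 DB\Pi^*+\Pi\widehat D B X^*.$$
   Context: Notation: $[P,Q]:=PQ-QP$; $^*$ denotes the conjugate transpose; subscripts $x,t$ denote partial derivatives; $\mathrm i$ is the imaginary unit. The two equalities are the necessary compatibility conditions $\Pi_{xt}=\Pi_{tx}$ and $S_{xt}=S_{tx}$ for the systems $\Pi_x=-\mathrm i A\Pi D+\Pi[D,\varrho]$, $\Pi_t=-\mathrm i A\Pi\widehat D+\Pi[\widehat D,\varrho]$ and $S_x=\Pi DB\Pi^*$, $S_t=\Pi\widehat DB\Pi^*$. They are understood as identities after the indicated substitution, without assuming in advance that these systems are jointly solvable. *)

(* Defs.v *)
From mathcomp Require Import all_boot all_order all_algebra.
From mathcomp Require Import spectral complex.
From mathcomp Require Import boolp classical_sets reals topology normedtype.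

Set Implicit Arguments.
Unset Strict Implicit.
Unset Printing Implicit Defensive.

Import Order.TTheory GRing.Theory Num.Theory.
Import numFieldNormedType.Exports.

Local Open Scope classical_set_scope.
Local Open Scope complex_scope.
Local Open Scope ring_scope.

Definition commutator_mx (K : pzRingType) (m : nat) (P Q : 'M[K]_m) : 'M[K]_m :=
  P *m Q - Q *m P.

Definition real_diag_mx (R : rcfType) (m : nat) (d : 'rV[R]_m) : 'M[R[i]]_m :=
  diag_mx (\row_k (d 0 k)%:C).

Definition quadrant (R : realType) : set (R * R) :=
  [set p | 0 <= p.1 /\ 0 <= p.2].
Arguments quadrant : clear implicits.

(* Total (Frechet) differentiability relative to the closed quadrant: at
   boundary points only increments staying in the quadrant are considered. *)
Definition quadrant_differentiable_at (R : realType) (f : R -> R -> R)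
    (x t : R) : Prop :=
  exists a b : R, forall e : R, 0 < e ->
    \forall q \near within (quadrant R) (nbhs (x, t)),
      `|f q.1 q.2 - f x t - (a * (q.1 - x) + b * (q.2 - t))|
        <= e * Num.max `|q.1 - x| `|q.2 - t|.

Definition quadrant_differentiable_mx (R : realType) (m : nat)
    (rho : R -> R -> 'M[R[i]]_m) : Prop :=
  forall x t : R, 0 <= x -> 0 <= t -> forall i j : 'I_m,
    quadrant_differentiable_at (fun y s => complex.Re (rho y s i j)) x t /\
    quadrant_differentiable_at (fun y s => complex.Im (rho y s i j)) x t.

(* Derivative on the half-line [0, +oo[, hence one-sided at s = 0. *)
Definition halfline_derive (R : realType) (f : R -> R) (s : R) : R :=
  lim (h^-1 * (f (s + h) - f s)
         @[h --> within [set h : R | 0 <= s + h] 0^']).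

Definition halfline_derive_mx (R : realType) (m : nat)
    (F : R -> 'M[R[i]]_m) (s : R) : 'M[R[i]]_m :=
  \matrix_(i, j)
    (halfline_derive (fun y => complex.Re (F y i j)) s
     +i* halfline_derive (fun y => complex.Im (F y i j)) s).

Definition partial_x (R : realType) (m : nat) (rho : R -> R -> 'M[R[i]]_m)
    (x t : R) : 'M[R[i]]_m :=
  halfline_derive_mx (fun y => rho y t) x.

Definition partial_t (R : realType) (m : nat) (rho : R -> R -> 'M[R[i]]_m)
    (x t : R) : 'M[R[i]]_m :=
  halfline_derive_mx (fun s => rho x s) t.

(* Main.v *)
Require Import Defs.
From mathcomp Require Import all_boot all_order all_algebra.
From mathcomp Require Import spectral complex.
From mathcomp Require Import reals.

Local Open Scope complex_scope.
Local Open Scope sesquilinear_scope.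
Local Open Scope ring_scope.

Import GRing.Theory Num.Theory.

(** Both equalities are pure algebra at a fixed point [(x, t)]. Write
    [V = [D, rho]] and [W = [Dhat, rho]], and let [c] stand for minus the
    imaginary unit.

    Differentiating [X = c A Pi D + Pi V] along the [t]-flow produces a term
    quadratic in [A], which is symmetric in the two flows because [D] and
    [Dhat] commute, a term linear in [A] and a term free of [A]. The linear
    terms agree by [[Dhat, V] = [D, W]], the Jacobi identity for commuting [D]
    and [Dhat]. The terms free of [A] differ by [Pi] times the
    zero-curvature expression [[D, rho_t] - [Dhat, rho_x] - [V, W]], which
    vanishes by the N-wave equation.

    For the second equality, the reduction [rho^* = B rho B] makes [V] and [W]
    skew with respect to the indefinite form given by [B], that is
    [B V^* = - V B]. Each side is thereby brought to the form of
    [flow_hermitian_form], where the two flows enter only through products of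
    the commuting matrices [D], [Dhat], [B] and through the iterated
    commutators [[Dhat, V]] and [[D, W]], equal by the same Jacobi identity. *)

(** This is the Jacobi identity, its third term vanishing as [[D, E] = 0]. *)
Lemma commutator_mx_swap (K : pzRingType) (m : nat) (D E r : 'M[K]_m) :
  D *m E = E *m D ->
  commutator_mx E (commutator_mx D r) = commutator_mx D (commutator_mx E r).
Proof.
move=> DE; rewrite /commutator_mx !mulmxBr !mulmxBl !mulmxA DE.
rewrite -(mulmxA r E D) -DE mulmxA !opprB.
by rewrite addrACA [RHS]addrACA; congr (_ + _); rewrite addrC.
Qed.

(** Separating the powers of [A] in two successive applications of the flows
    reduces their compatibility to a comparison of coefficients. *)
Lemma flow_comp (K : comPzRingType) (m n : nat) (c : K) (A : 'M[K]_n)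
    (P : 'M[K]_(n, m)) (D E V W : 'M[K]_m) :
  let X := c *: (A *m P *m D) + P *m V in
  c *: (A *m X *m E) + X *m W =
  (c * c) *: (A *m A *m P *m (D *m E)) + c *: (A *m P *m (V *m E + D *m W))
  + P *m (V *m W).
Proof.
rewrite /= !mulmxDr !mulmxDl -!scalemxAr -!scalemxAl scalerDr scalerA !mulmxA.
by rewrite scalerDr !addrA.
Qed.

(** The first equality over any commutative ring: [Vt] and [Wx] stand for the
    derivatives of [V] and [W], so the last hypothesis is the zero-curvature
    equation of the pair [V], [W]. *)
Lemma flow_compatible_zero_curvature (K : comPzRingType) (m n : nat) (c : K)
    (A : 'M[K]_n) (P : 'M[K]_(n, m)) (D E V W Vt Wx : 'M[K]_m) :
  D *m E = E *m D -> commutator_mx E V = commutator_mx D W ->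
  Vt - Wx = commutator_mx V W ->
  let X := c *: (A *m P *m D) + P *m V in
  let T := c *: (A *m P *m E) + P *m W in
  c *: (A *m T *m D) + T *m V + P *m Vt = c *: (A *m X *m E) + X *m W + P *m Wx.
Proof.
move=> DE EV_DW curv X T.
rewrite (flow_comp _ _ _ c A P E D W V) (flow_comp _ _ _ c A P D E V W) DE.
rewrite -!addrA -!mulmxDr.
have -> : W *m D + E *m V = V *m E + D *m W.
  move/eqP: EV_DW; rewrite /commutator_mx subr_eq => /eqP ->.
  by rewrite -addrA addrCA [_ + (- _ + _)]addrA subrr add0r addrC.
have -> : W *m V + Vt = V *m W + Wx.
  move/eqP: curv; rewrite subr_eq => /eqP ->.
  by rewrite /commutator_mx addrA addrCA subrr addr0.
by [].
Qed.

Lemma trmxC_mul (C : numClosedFieldType) (m n p : nat) (M : 'M[C]_(m, n))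
    (N : 'M[C]_(n, p)) : (M *m N) ^t* = N ^t* *m M ^t*.
Proof. by rewrite trmx_mul map_mxM. Qed.

(** The hypothesis on [V] says that it is skew-adjoint for the form defined by
    [B]; it is what lets both terms in [V] combine into a commutator. *)
Lemma flow_hermitian_form (C : numClosedFieldType) (m n : nat) (c : C)
    (A : 'M[C]_n) (P : 'M[C]_(n, m)) (D E B V : 'M[C]_m) :
  D ^t* = D -> B *m V ^t* = - (V *m B) ->
  let X := c *: (A *m P *m D) + P *m V in
  X *m E *m B *m P ^t* + P *m E *m B *m X ^t* =
  c *: (A *m P *m (D *m E) *m B *m P ^t*)
  + c^* *: (P *m (E *m B *m D) *m P ^t* *m A ^t*)
  - P *m commutator_mx E V *m B *m P ^t*.
Proof.
move=> Dadj Vskew X.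
have -> : X ^t* = c^* *: (D *m P ^t* *m A ^t*) + V ^t* *m P ^t*.
  by rewrite /X linearD /= map_mxD linearZ /= map_mxZ !trmxC_mul Dadj mulmxA.
rewrite /X mulmxDr -scalemxAr !mulmxA -(mulmxA _ B (V ^t*)) Vskew.
rewrite /commutator_mx !mulmxDl -!scalemxAl !mulmxN mulNmx !mulmxBr !mulmxBl.
rewrite !mulmxA opprB -!addrA; congr (_ + _).
by rewrite addrCA.
Qed.

Lemma flow_hermitian_form_compatible (C : numClosedFieldType) (m n : nat)
    (c : C) (A : 'M[C]_n) (P : 'M[C]_(n, m)) (D E B V W : 'M[C]_m) :
  D ^t* = D -> E ^t* = E ->
  D *m E = E *m D -> B *m D = D *m B -> B *m E = E *m B ->
  B *m V ^t* = - (V *m B) -> B *m W ^t* = - (W *m B) ->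
  commutator_mx E V = commutator_mx D W ->
  let X := c *: (A *m P *m D) + P *m V in
  let T := c *: (A *m P *m E) + P *m W in
  T *m D *m B *m P ^t* + P *m D *m B *m T ^t* =
  X *m E *m B *m P ^t* + P *m E *m B *m X ^t*.
Proof.
move=> Dadj Eadj DE BD BE Vskew Wskew EV_DW X T.
rewrite (flow_hermitian_form _ _ _ c A P E D B W Eadj Wskew).
rewrite (flow_hermitian_form _ _ _ c A P D E B V Dadj Vskew).
have -> : D *m B *m E = E *m B *m D by rewrite -!mulmxA BE BD !mulmxA DE.
by rewrite EV_DW DE.
Qed.

Lemma conjc_real (R : rcfType) (r : R) : (r%:C)^*%R = r%:C.
Proof. by apply/conj_Creal; rewrite complex_real. Qed.

Lemma real_diag_mx_trmxC (R : rcfType) (m : nat) (d : 'rV[R]_m) :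
  (real_diag_mx d) ^t* = real_diag_mx d.
Proof.
rewrite /real_diag_mx tr_diag_mx map_diag_mx; congr diag_mx.
apply/rowP => k; rewrite !mxE; exact: conjc_real.
Qed.

Lemma real_diag_mxC (R : rcfType) (m : nat) (d e : 'rV[R]_m) :
  real_diag_mx d *m real_diag_mx e = real_diag_mx e *m real_diag_mx d.
Proof. exact: diag_mxC. Qed.

Lemma real_diag_mx_signs_sqr (R : rcfType) (m : nat) (b : 'rV[R]_m) :
  (forall k, b 0 k = 1 \/ b 0 k = -1) ->
  real_diag_mx b *m real_diag_mx b = 1%:M.
Proof.
move=> hb; rewrite /real_diag_mx mulmx_diag -diag_const_mx; congr diag_mx.
apply/rowP => k; rewrite !mxE -rmorphM /=.
by case: (hb k) => ->; rewrite ?mulrNN mulr1.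
Qed.

(** Taking adjoints reverses the order in the commutator, hence the sign; the
    conjugation by the involution [B] passes through since [B] commutes with
    [D]. *)
Lemma commutator_mx_skew (C : numClosedFieldType) (m : nat)
    (D B r : 'M[C]_m) :
  D ^t* = D -> B *m D = D *m B -> B *m B = 1%:M -> r ^t* = B *m r *m B ->
  B *m (commutator_mx D r) ^t* = - (commutator_mx D r *m B).
Proof.
move=> Dadj BD BB radj.
rewrite /commutator_mx linearB /= map_mxB !trmxC_mul Dadj radj.
rewrite mulmxBr mulmxBl opprB !mulmxA BB mul1mx -(mulmxA r) BD.
by rewrite -(mulmxA D B B) BB mulmx1 mulmxA.
Qed.

Theorem proposition3p1 (R : realType) (m n : nat)
    (d dhat b : 'rV[R]_m) (A : 'M[R[i]]_n) (rho : R -> R -> 'M[R[i]]_m)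
    (hb : forall k : 'I_m, b 0 k = 1 \/ b 0 k = -1)
    (rho_diff : quadrant_differentiable_mx rho)
    (rho_sym : forall x t : R, 0 <= x -> 0 <= t ->
       rho x t ^t* = real_diag_mx b *m rho x t *m real_diag_mx b)
    (rho_Nwave : forall x t : R, 0 <= x -> 0 <= t ->
       commutator_mx (real_diag_mx d) (partial_t rho x t)
       - commutator_mx (real_diag_mx dhat) (partial_x rho x t)
       = commutator_mx (commutator_mx (real_diag_mx d) (rho x t))
                       (commutator_mx (real_diag_mx dhat) (rho x t))) :
  let D := real_diag_mx d in
  let Dhat := real_diag_mx dhat in
  let B := real_diag_mx b in
  forall x t : R, 0 <= x -> 0 <= t -> forall Pi : 'M[R[i]]_(n, m),
  let X := - 'i%C *: (A *m Pi *m D) + Pi *m commutator_mx D (rho x t) in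
  let T := - 'i%C *: (A *m Pi *m Dhat) + Pi *m commutator_mx Dhat (rho x t) in
  (- 'i%C *: (A *m T *m D) + T *m commutator_mx D (rho x t)
     + Pi *m commutator_mx D (partial_t rho x t)
   = - 'i%C *: (A *m X *m Dhat) + X *m commutator_mx Dhat (rho x t)
     + Pi *m commutator_mx Dhat (partial_x rho x t)) /\
  (T *m D *m B *m Pi ^t* + Pi *m D *m B *m T ^t*
   = X *m Dhat *m B *m Pi ^t* + Pi *m Dhat *m B *m X ^t*).
Proof.
move=> D Dhat B x t x0 t0 Pi X T.
have DDh : D *m Dhat = Dhat *m D by exact: real_diag_mxC.
have jacobi := commutator_mx_swap _ _ _ _ (rho x t) DDh.
have nwave := rho_Nwave x t x0 t0; rewrite -/D -/Dhat in nwave.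
have skew e : B *m (commutator_mx (real_diag_mx e) (rho x t)) ^t*
    = - (commutator_mx (real_diag_mx e) (rho x t) *m B).
  apply: commutator_mx_skew; last exact: rho_sym.
  - exact: real_diag_mx_trmxC.
  - exact: real_diag_mxC.
  - exact: real_diag_mx_signs_sqr.
rewrite /X /T; move: (- 'i%C) => c.
split.
  exact: (flow_compatible_zero_curvature _ _ _ c A Pi D Dhat _ _ _ _
    DDh jacobi nwave).
exact: (flow_hermitian_form_compatible _ _ _ c A Pi D Dhat B _ _
  (real_diag_mx_trmxC _ _ d) (real_diag_mx_trmxC _ _ dhat) DDh
  (real_diag_mxC _ _ b d) (real_diag_mxC _ _ b dhat) (skew d) (skew dhat)
  jacobi).
Qed.
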